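(* Assume Assumption A and that the design is strongly stable with limit $p^\star$. Let $N_1=\sum_{i=1}^NK_i$, $N_0=N-N_1$, and $$\widehat m_0^2=\frac{1}{\max\{N_0,1\}}\sum_{i=1}^N(1-K_i)Y_i^2,\qquad \widehat m_1^2=\frac{1}{\max\{N_1,1\}}\sum_{i=1}^NK_iY_i^2,$$ $$\widehat V^{\mathrm{IPW}}_{\mathrm{strong}}=\Big(\widehat m_0\sqrt{\tfrac{p^\star}{1-p^\star}}+\widehat m_1\sqrt{\tfrac{1-p^\star}{p^\star}}\Big)^2 ,$$ where $\widehat m_\ell=\sqrt{\widehat m_\ell^2}$. Then $\widehat m_0^2\xrightarrow{p}m_0^2$ and $\widehat m_1^2\xrightarrow{p}m_1^2$; moreover $\widehat V^{\mathrm{IPW}}_{\mathrm{strong}}$ converges in probability to $\big(m_0\sqrt{p^\star/(1-p^\star)}+m_1\sqrt{(1-p^\star)/p^\star}\big)^2$, which is $\ge V^{\mathrm{IPW}}_{\mathrm{strong}}:=m_0^2\frac{p^\star}{1-p^\star}+m_1^2\frac{1-p^\star}{p^\star}+2m_{01}$ (so the estimator is conservative), and $\widehat V^{\mathrm{IPW}}_{\mathrm{strong}}$ is consistent for $V^{\mathrm{IPW}}_{\mathrm{strong}}$ when the potential outcomes are additive on the log scale, i.e. $Y_i(1)=cY_i(0)$ for all $i$ for some constant $c\in\mathbb R$.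
   Context: Setup. Let $(Y_i(0),Y_i(1))_{i\ge1}$ be a fixed (non-random) sequence of pairs of real numbers (potential outcomes under control and treatment). For each $N$ the experiment consists of units $1,\dots,N$. Random treatment indicators $K_1,K_2,\dots\in\{0,1\}$ are assigned sequentially and the observed outcome is $Y_i=K_iY_i(1)+(1-K_i)Y_i(0)$. Let $\mathcal F_0$ be the trivial $\sigma$-field and $\mathcal F_{i-1}=\sigma(K_1,Y_1,\dots,K_{i-1},Y_{i-1})$. A sequential design is a sequence of random variables $(p_i)_{i\ge1}$ (inclusion probabilities) such that $p_i$ is $\mathcal F_{i-1}$-measurable and $\mathbb P(K_i=1\mid\mathcal F_{i-1})=p_i$. Strong design stability: there is a non-random $p^\star\in(0,1)$ with $p_i\xrightarrow{p}p^\star$ as $i\to\infty$. Assumption A: (a) there is $\delta\in(0,1)$ with $p_i\in[\delta,1-\delta]$ for all $i\ge1$; (b) there is $M>0$ with $|Y_i(\ell)|\le M$ for all $i\ge1$, $\ell\in\{0,1\}$; (c) the limits $m_0^2=\lim_N\frac1N\sum_{i=1}^NY_i(0)^2$, $m_1^2=\lim_N\frac1N\sum_{i=1}^NY_i(1)^2$, $m_{01}=\lim_N\frac1N\sum_{i=1}^NY_i(0)Y_i(1)$ exist, with $m_0^2,m_1^2>0$ and $m_{01}\in\mathbb R$; $m_\ell=\sqrt{m_\ell^2}$.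
   Formalization: The last claim is stated for Y_i(1) = cY_i(0) with c > 0 instead of c ∈ ℝ: for c < 0 it is false (Y_i(0)=1, Y_i(1)=−1, p_i=1/2 gives limit 4 but V = 0), and c = 0 is excluded by m_1² > 0. *)

(* Defs.v *)
From HB Require Import structures.
From mathcomp Require Import all_boot all_order all_algebra.
From mathcomp Require Import all_classical all_reals all_analysis.
Set Implicit Arguments. Unset Strict Implicit. Unset Printing Implicit Defensive.
Import Order.TTheory GRing.Theory Num.Theory.
Import numFieldNormedType.Exports.
Local Open Scope classical_set_scope.
Local Open Scope ring_scope.

Section Defs.
Context {d : measure_display} {T : measurableType d} {R : realType}.

(* Observed outcome Y_i = K_i Y_i(1) + (1 - K_i) Y_i(0)  (units indexed from 0). *)
Definition Yobs (Y0 Y1 : nat -> R) (K : nat -> T -> R) (i : nat) (t : T) : R :=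
  K i t * Y1 i + (1 - K i t) * Y0 i.

Definition past_gen (Y0 Y1 : nat -> R) (K : nat -> T -> R) (i : nat) : set (set T) :=
  [set A | exists j, (j < i)%N /\ exists B : set R, measurable B /\
       (A = K j @^-1` B \/ A = Yobs Y0 Y1 K j @^-1` B)].

(* F_{i} in 0-based indexing: the sigma-field generated by (K_j, Y_j), j < i
   (on the whole space; for i = 0 it is the trivial sigma-field). *)
Definition past (Y0 Y1 : nat -> R) (K : nat -> T -> R) (i : nat) : set (set T) :=
  <<s setT, past_gen Y0 Y1 K i >>.

Definition measurable_wrt (F : set (set T)) (X : T -> R) : Prop :=
  forall B : set R, measurable B -> F (X @^-1` B).

(* Sequential design: p i is F_i-measurable and P(K_i = 1 | F_i) = p_i, the
   conditional probability being characterized by its defining property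
   P(A /\ K_i = 1) = E[p_i 1_A] for every A in F_i. *)
Definition sequential_design (P : probability T R) (Y0 Y1 : nat -> R)
    (K : nat -> T -> R) (p : nat -> T -> R) : Prop :=
  (forall i, measurable_fun setT (K i)) /\
  (forall i t, K i t = 0 \/ K i t = 1) /\
  (forall i, measurable_wrt (past Y0 Y1 K i) (p i)) /\
  (forall i A, past Y0 Y1 K i A ->
     P (A `&` [set t | K i t = 1]) = (\int[P]_(t in A) (p i t)%:E)%E).

Definition cvg_in_prob (P : probability T R) (X : nat -> T -> R) (x : R) : Prop :=
  forall e : R, 0 < e ->
    (fun n => P [set t | e < `|X n t - x|]) @ \oo --> 0%E.

Definition N1 (K : nat -> T -> R) (N : nat) (t : T) : R := \sum_(i < N) K i t.
Definition N0 (K : nat -> T -> R) (N : nat) (t : T) : R := N%:R - N1 K N t.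

Definition hat_m0sq (Y0 Y1 : nat -> R) (K : nat -> T -> R) (N : nat) (t : T) : R :=
  (Num.max (N0 K N t) 1)^-1 * \sum_(i < N) (1 - K i t) * Yobs Y0 Y1 K i t ^+ 2.
Definition hat_m1sq (Y0 Y1 : nat -> R) (K : nat -> T -> R) (N : nat) (t : T) : R :=
  (Num.max (N1 K N t) 1)^-1 * \sum_(i < N) K i t * Yobs Y0 Y1 K i t ^+ 2.

Definition hat_V_strong (pstar : R) (Y0 Y1 : nat -> R) (K : nat -> T -> R)
    (N : nat) (t : T) : R :=
  (Num.sqrt (hat_m0sq Y0 Y1 K N t) * Num.sqrt (pstar / (1 - pstar)) +
   Num.sqrt (hat_m1sq Y0 Y1 K N t) * Num.sqrt ((1 - pstar) / pstar)) ^+ 2.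

End Defs.

Definition V_strong {R : realType} (pstar m0sq m1sq m01 : R) : R :=
  m0sq * (pstar / (1 - pstar)) + m1sq * ((1 - pstar) / pstar) + 2 * m01.

(* Main.v *)
Require Import Defs.
From HB Require Import structures.
From mathcomp Require Import all_boot all_order all_algebra.
From mathcomp Require Import all_classical all_reals all_analysis.
From mathcomp Require Import measurable_realfun ring lra.
Import Order.TTheory GRing.Theory Num.Theory.
Import numFieldNormedType.Exports.
Local Open Scope classical_set_scope.
Local Open Scope ring_scope.

(** Write [q = pstar].  For [j < i] the event [K_j = 1] lies in [F_i], so
    conditioning gives [E[(K_i - q)(K_j - q)] = E[(p_i - q)(K_j - q)]], which is
    at most [eps_i = E|p_i - q|] in absolute value and tends to [0] by
    stability.  Hence the second moment of [n^-1 sum_i a_i (K_i - q)] is, for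
    bounded weights [a], at most a constant times
    [n^-1 + 2 n^-1 sum_i eps_i], which tends to [0] by Cesaro, and Chebyshev
    gives a weak law of large numbers.  Centering at [q] rather than at [p_i]
    means that only the defining property of the conditional probability on
    events is needed.  The weak law with weights [1] and [Y_i(l)^2] yields the
    consistency of the ratios [hat_m_l^2], the variance estimator is a
    continuous function of them, and conservativeness is the Cauchy-Schwarz
    inequality [m01 <= m0 m1], an equality when [Y_i(1) = c Y_i(0)], [c > 0]. *)

(** * Expectations of bounded variables, Chebyshev's inequality and mappings in probability *)

Section Expectation.
Local Set Implicit Arguments.
Local Unset Strict Implicit.
Context {d : measure_display} {T : measurableType d} {R : realType}.
Variable P : probability T R.
Implicit Types (X Y Z : T -> R) (A : set T).

(** A pointwise bound is closed under sums and products and implies integrability under a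
    probability, so one predicate discharges every integrability condition on [Ex] below. *)
Definition bounded_rv X :=
  measurable_fun setT X /\ exists M : R, forall t, `|X t| <= M.

Definition Ex X : R := \int[P]_t X t.

Lemma bounded_rv_cst (c : R) : bounded_rv (fun=> c).
Proof. by split; [exact: measurable_cst|exists `|c|]. Qed.

Lemma bounded_rvD X Y :
  bounded_rv X -> bounded_rv Y -> bounded_rv (fun t => X t + Y t).
Proof.
move=> [mX [M XM]] [mY [N YN]]; split; first exact: measurable_funD.
by exists (M + N) => t; rewrite (le_trans (ler_normD _ _))// lerD.
Qed.

Lemma bounded_rvM X Y :
  bounded_rv X -> bounded_rv Y -> bounded_rv (fun t => X t * Y t).
Proof.
move=> [mX [M XM]] [mY [N YN]]; split; first exact: measurable_funM.
by exists (M * N) => t; rewrite normrM ler_pM.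
Qed.

Lemma bounded_rvZ (c : R) X : bounded_rv X -> bounded_rv (fun t => c * X t).
Proof. exact/bounded_rvM/bounded_rv_cst. Qed.

Lemma bounded_rvB X Y :
  bounded_rv X -> bounded_rv Y -> bounded_rv (fun t => X t - Y t).
Proof.
move=> bX /(bounded_rvZ (-1)) bY; have := bounded_rvD bX bY.
by under eq_fun do rewrite mulN1r.
Qed.

Lemma bounded_rv_norm X : bounded_rv X -> bounded_rv (fun t => `|X t|).
Proof.
move=> [mX [M XM]]; split; first exact: measurableT_comp.
by exists M => t; rewrite normr_id.
Qed.

Lemma bounded_rv_sum n (X : nat -> T -> R) :
  (forall i, bounded_rv (X i)) -> bounded_rv (fun t => \sum_(i < n) X i t).
Proof.
move=> bX; elim: n => [|n IHn].
  by under eq_fun do rewrite big_ord0; exact: bounded_rv_cst.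
by under eq_fun do rewrite big_ord_recr/=; exact: bounded_rvD.
Qed.

Lemma bounded_rv_indic A : measurable A -> bounded_rv (\1_A : T -> R).
Proof.
move=> mA; split; first exact: measurable_indic.
by exists 1 => t; rewrite indicE ger0_norm ?ler0n// lern1 leq_b1.
Qed.

Lemma bounded_rv_integrable X : bounded_rv X -> P.-integrable setT (EFin \o X).
Proof.
move=> [mX [M XM]]; apply: measurable_bounded_integrable => //.
- by apply: (le_lt_trans (probability_le1 P _)) => //; rewrite ltry.
- by exists M; split; [exact: num_real|move=> N /ltW MN t _; exact: le_trans MN].
Qed.

Lemma ExD X Y : bounded_rv X -> bounded_rv Y ->
  Ex (fun t => X t + Y t) = Ex X + Ex Y.
Proof. by move=> bX bY; rewrite /Ex RintegralD//; exact: bounded_rv_integrable. Qed.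

Lemma ExB X Y : bounded_rv X -> bounded_rv Y ->
  Ex (fun t => X t - Y t) = Ex X - Ex Y.
Proof. by move=> bX bY; rewrite /Ex RintegralB//; exact: bounded_rv_integrable. Qed.

Lemma ExZ (c : R) X : bounded_rv X -> Ex (fun t => c * X t) = c * Ex X.
Proof. by move=> bX; rewrite /Ex RintegralZl//; exact: bounded_rv_integrable. Qed.

Lemma Ex_cst (c : R) : Ex (fun=> c) = c.
Proof. by rewrite /Ex Rintegral_cst//= probability_setT mulr1. Qed.

Lemma Ex_sum n (X : nat -> T -> R) : (forall i, bounded_rv (X i)) ->
  Ex (fun t => \sum_(i < n) X i t) = \sum_(i < n) Ex (X i).
Proof.
move=> bX; elim: n => [|n IHn].
  by under eq_fun do rewrite big_ord0; rewrite big_ord0 Ex_cst.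
under eq_fun do rewrite big_ord_recr/=.
by rewrite ExD ?IHn ?big_ord_recr//; exact: bounded_rv_sum.
Qed.

Lemma Ex_le X Y : bounded_rv X -> bounded_rv Y -> (forall t, X t <= Y t) ->
  Ex X <= Ex Y.
Proof. by move=> bX bY XY; apply: le_Rintegral => //; exact: bounded_rv_integrable. Qed.

Lemma Ex_norm X : bounded_rv X -> `|Ex X| <= Ex (fun t => `|X t|).
Proof. by move=> bX; apply: le_normr_Rintegral => //; exact: bounded_rv_integrable. Qed.

Lemma Ex_indic A : measurable A -> (Ex \1_A)%:E = P A.
Proof.
move=> mA; rewrite /Ex /Rintegral integral_indic// setIT fineK//.
exact: fin_num_measure.
Qed.

Lemma measurable_deviation X (x e : R) : measurable_fun setT X ->
  measurable [set t | e < `|X t - x|].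
Proof.
move=> mX; have mXx : measurable_fun setT (fun t => `|X t - x|).
  by apply: measurableT_comp => //; exact: (measurable_funB mX (measurable_cst x)).
rewrite -[X in measurable X]setTI.
exact: (measurable_fun_ltr (measurable_cst e) mXx measurableT (Y := [set true])).
Qed.

(** The indicator of the event is at most [e ^- 2 * (X t - x) ^+ 2] pointwise; the centre [x] is
    arbitrary and need not be the mean. *)
Lemma chebyshev_ineq X (x e : R) : 0 < e -> bounded_rv X ->
  (P [set t | (e < `|X t - x|)%R] <= (e ^- 2 * Ex (fun t => (X t - x) ^+ 2))%:E)%E.
Proof.
move=> e0 bX; have mA := measurable_deviation x e bX.1.
have bXx : bounded_rv (fun t => (X t - x) ^+ 2).
  by apply: bounded_rvM; apply: bounded_rvB => //; exact: bounded_rv_cst.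
rewrite -Ex_indic// lee_fin -ExZ//; apply: Ex_le.
- exact: bounded_rv_indic.
- exact: bounded_rvZ.
move=> t; rewrite indicE; case: (boolP (t \in _)) => [|_].
  rewrite inE/= => eX; rewrite mulrC ler_pdivlMr ?exprn_gt0// mul1r.
  by rewrite -[leRHS]real_normK ?num_real// ler_sqr ?nnegrE ?(ltW e0)// ltW.
by rewrite mulr_ge0 ?invr_ge0 ?sqr_ge0 ?exprn_ge0 ?ltW.
Qed.

(** Pointwise, [|X|] is at most [e] off the deviation event and at most [M] on it. This upgrades
    convergence in probability of bounded variables to convergence in mean. *)
Lemma Ex_norm_le X (M e : R) : bounded_rv X -> (forall t, `|X t| <= M) -> 0 <= e ->
  Ex (fun t => `|X t|) <= e + M * fine (P [set t | e < `|X t - 0|]).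
Proof.
move=> bX XM e0; set A := [set t | _].
have mA : measurable A := measurable_deviation 0 e bX.1.
have bA := bounded_rv_indic mA.
rewrite -(Ex_indic mA)/= -ExZ// -[e in e + _]Ex_cst -ExD//; last 2 first.
- exact: bounded_rv_cst.
- exact: bounded_rvZ.
apply: Ex_le.
- exact: bounded_rv_norm.
- by apply: bounded_rvD; [exact: bounded_rv_cst|exact: bounded_rvZ].
move=> t; rewrite indicE; have M0 := le_trans (normr_ge0 _) (XM t).
have [_|] := boolP (t \in A); first by rewrite mulr1 -[leLHS]add0r lerD.
rewrite notin_setE => nA; rewrite mulr0 addr0 leNgt; apply/negP => eX.
by apply: nA; rewrite /A/= subr0.
Qed.

(** A large deviation of [Z n] forces one of [X n] or of [Y n], so a union bound concludes. Asking
    for the implication only for large [n] lets [Z n] depend on [n] otherwise than through a fixed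
    function of [X n] and [Y n], as the ratio estimators do. *)
Lemma cvg_in_prob_comp2 (X Y Z : nat -> T -> R) (x y z : R) :
  (forall n, measurable_fun setT (X n)) ->
  (forall n, measurable_fun setT (Y n)) ->
  (forall n, measurable_fun setT (Z n)) ->
  (forall e : R, 0 < e -> exists2 r : R, 0 < r & \forall n \near \oo, forall t,
     `|X n t - x| <= r -> `|Y n t - y| <= r -> `|Z n t - z| <= e) ->
  cvg_in_prob P X x -> cvg_in_prob P Y y -> cvg_in_prob P Z z.
Proof.
move=> mX mY mZ XYZ cX cY e e0; have [r r0 XYZr] := XYZ _ e0.
have := cvgeD (isT : ((0 : \bar R) +? 0)%E) (cX _ r0) (cY _ r0).
rewrite adde0 => /(_ eventually_filter) cXY.
apply: squeeze_cvge (cvg_cst 0%E) cXY.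
near=> n; rewrite measure_ge0/=.
have XYZn t : `|X n t - x| <= r -> `|Y n t - y| <= r -> `|Z n t - z| <= e.
  by move: t; near: n.
have mXn := measurable_deviation x r (mX n).
have mYn := measurable_deviation y r (mY n).
have mZn := measurable_deviation z e (mZ n).
apply: (le_trans _ (measureU2 P mXn mYn)).
apply: le_measure; rewrite ?inE//; first exact: measurableU.
move=> t /= eZ.
have [Xr|] := leP `|X n t - x| r; last by left.
have [Yr|] := leP `|Y n t - y| r; last by right.
by move: eZ; rewrite ltNge XYZn.
Unshelve. all: by end_near. Qed.

End Expectation.

(** * A weak law for weighted sums with small correlations *)

Section WeakLLN.
Local Set Implicit Arguments.
Local Unset Strict Implicit.
Context {d : measure_display} {T : measurableType d} {R : realType}.
Variable P : probability T R.
Variables (Z : nat -> T -> R) (a eps : nat -> R) (A : R).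
Hypothesis mZ : forall i, measurable_fun setT (Z i).
Hypothesis Z1 : forall i t, `|Z i t| <= 1.
Hypothesis aA : forall i, `|a i| <= A.
Hypothesis covZ : forall i j, (j < i)%N ->
  `|Ex P (fun t => Z i t * Z j t)| <= eps i.
Hypothesis eps_ge0 : forall i, 0 <= eps i.
Hypothesis eps0 : eps @ \oo --> 0.

Let S n t := \sum_(i < n) a i * Z i t.

Let bZ i : bounded_rv (Z i). Proof. by split; [exact: mZ|exists 1]. Qed.

Let bS n : bounded_rv (S n).
Proof.
by apply: (bounded_rv_sum n (X := fun i t => a i * Z i t)) => i; exact: bounded_rvZ.
Qed.

Let bS2 n : bounded_rv (fun t => S n t ^+ 2). Proof. exact: bounded_rvM. Qed.

Let ExZS n : `|Ex P (fun t => Z n t * S n t)| <= A * (n%:R * eps n).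
Proof.
have A0 := le_trans (normr_ge0 _) (aA 0).
have -> : Ex P (fun t => Z n t * S n t) =
    \sum_(j < n) a j * Ex P (fun t => Z n t * Z j t).
  transitivity (Ex P (fun t => \sum_(j < n) a j * (Z n t * Z j t))).
    congr Ex; apply/funext => t; rewrite mulr_sumr.
    by apply: eq_bigr => j _; rewrite mulrCA.
  rewrite (Ex_sum P n (X := fun j t => a j * (Z n t * Z j t))); last first.
    by move=> j; apply: bounded_rvZ; exact: bounded_rvM.
  by apply: eq_bigr => j _; rewrite ExZ//; exact: bounded_rvM.
rewrite (le_trans (ler_norm_sum _ _ _))//.
have -> : A * (n%:R * eps n) = \sum_(j < n) A * eps n.
  by rewrite sumr_const card_ord -[RHS]mulr_natl mulrCA.
by apply: ler_sum => j _; rewrite normrM ler_pM// covZ.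
Qed.

(** Induction through the expansion of [(S n + a n * Z n) ^+ 2]: the diagonal term costs at most
    [A ^+ 2], and [ExZS] bounds the cross term by the [n] covariances of [Z n] with its
    predecessors. *)
Lemma second_moment_le n : Ex P (fun t => S n t ^+ 2) <=
  A ^+ 2 * \sum_(i < n) (1 + 2 * (i%:R * eps i)).
Proof.
have A0 := le_trans (normr_ge0 _) (aA 0).
elim: n => [|n IHn].
  rewrite /S big_ord0 mulr0; under eq_fun do rewrite big_ord0 expr0n/=.
  by rewrite Ex_cst.
have -> : (fun t => S n.+1 t ^+ 2) = (fun t =>
    S n t ^+ 2 + ((2 * a n) * (Z n t * S n t) + a n ^+ 2 * (Z n t * Z n t))).
  by apply/funext => t; rewrite /S big_ord_recr/=; ring.
have bZS : bounded_rv (fun t => Z n t * S n t) by exact: bounded_rvM.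
have bZZ : bounded_rv (fun t => Z n t * Z n t) by exact: bounded_rvM.
rewrite ExD//; last by apply: bounded_rvD; exact: bounded_rvZ.
rewrite big_ord_recr/= mulrDr lerD// ExD ?ExZ//; [|exact: bounded_rvZ..].
rewrite addrC mulrDr lerD//.
  rewrite mulr1; apply: (@le_trans _ _ (A ^+ 2 * 1)); last by rewrite mulr1.
  rewrite ler_pM ?sqr_ge0//.
  - by apply: Rintegral_ge0 => t _; rewrite -expr2 sqr_ge0.
  - by rewrite -[leLHS]real_normK ?num_real// ler_sqr ?nnegrE.
  rewrite -(Ex_cst P 1); apply: Ex_le => //; first exact: bounded_rv_cst.
  move=> t; rewrite -expr2 -[leLHS]real_normK ?num_real//.
  by rewrite expr_le1.
have -> : A ^+ 2 * (2 * (n%:R * eps n)) = (2 * A) * (A * (n%:R * eps n)) by ring.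
rewrite (le_trans (ler_norm _))// normrM ler_pM// normrM.
by rewrite ger0_norm// ler_pM2l.
Qed.

Lemma weighted_weak_lln :
  cvg_in_prob P (fun n t => n%:R^-1 * \sum_(i < n) a i * Z i t) 0.
Proof.
move=> e e0.
pose u n := e ^- 2 * (A ^+ 2 * (n%:R^-1 + 2 * (n%:R^-1 * \sum_(i < n) eps i))).
have u0 : u @ \oo --> (0 : R).
  (* Harmonic sequence and Cesaro means are both indexed from [n.+1], so the limit is taken along
     the shifted sequence. *)
  have us : u n.+1 @[n --> \oo] --> e ^- 2 * (A ^+ 2 * (0 + 2 * 0)).
    apply: cvgMl_tmp; apply: cvgMl_tmp; apply: cvgD; first exact: cvg_harmonic.
    apply: cvgMl_tmp; have := cesaro eps0; rewrite /arithmetic_mean/=.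
    by under eq_fun do rewrite seriesEnat/= big_mkord.
  by move: us; rewrite !(mulr0, addr0) (cvg_shiftS u).
have u0E : (u n)%:E @[n --> \oo] --> 0%E by apply: cvg_EFin => //; exact: nearW.
apply: squeeze_cvge (cvg_cst 0%E) u0E.
near=> n; rewrite measure_ge0/=.
have n0 : (0 < n)%N by near: n; exact: nbhs_infty_gt.
have bSn := bounded_rvZ n%:R^-1 (bS n).
apply: (le_trans (chebyshev_ineq P 0 e0 bSn)).
rewrite lee_fin ler_wpM2l ?invr_ge0 ?exprn_ge0 ?(ltW e0)//.
have -> : (fun t => (n%:R^-1 * S n t - 0) ^+ 2) =
    (fun t => n%:R^-1 ^+ 2 * S n t ^+ 2).
  by apply/funext => t; rewrite subr0 exprMn.
rewrite ExZ//.
apply: (le_trans (ler_wpM2l (sqr_ge0 _) (second_moment_le n))).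
rewrite mulrCA ler_wpM2l ?sqr_ge0//.
have nR : n%:R != 0 :> R by rewrite pnatr_eq0 -lt0n.
(* Replacing the factor [i] by the larger [n] in each summand leaves the plain Cesaro mean of
   [eps]. *)
have -> : n%:R^-1 + 2 * (n%:R^-1 * \sum_(i < n) eps i) =
    n%:R^-1 ^+ 2 * \sum_(i < n) (1 + 2 * (n%:R * eps i)) :> R.
  by rewrite big_split/= -!mulr_sumr sumr_const card_ord; field.
rewrite ler_wpM2l ?sqr_ge0//; apply: ler_sum => i _.
rewrite lerD2l ler_pM2l// ler_wpM2r// ?ler_nat ?ltW//; last exact: ltnW.
Unshelve. all: by end_near. Qed.

End WeakLLN.

(** * The weak law for treatment indicators of a stable sequential design *)

Section SequentialDesign.
Local Set Implicit Arguments.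
Local Unset Strict Implicit.
Context {d : measure_display} {T : measurableType d} {R : realType}.
Variable P : probability T R.
Variables (Y0 Y1 : nat -> R) (K p : nat -> T -> R) (q : R).
Hypothesis design : sequential_design P Y0 Y1 K p.
Hypothesis p01 : forall i t, 0 <= p i t <= 1.
Hypothesis q01 : 0 <= q <= 1.
Hypothesis pq : cvg_in_prob P p q.

Let mK i : measurable_fun setT (K i). Proof. by case: design. Qed.

Let K01 i t : K i t = 0 \/ K i t = 1. Proof. by case: design => _ []. Qed.

Lemma measurable_Yobs i : measurable_fun setT (Yobs Y0 Y1 K i).
Proof.
apply: (measurable_funD (f := fun t => K i t * Y1 i)
                        (g := fun t => (1 - K i t) * Y0 i)).
  exact: (measurable_funM (mK i) (measurable_cst (Y1 i))).
apply: (measurable_funM (f := fun t => 1 - K i t) _ (measurable_cst (Y0 i))).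
exact: (measurable_funB (measurable_cst (1 : R)) (mK i)).
Qed.

(** The generators are preimages under the measurable [K j] and [Yobs j]. Hence [p i], measurable
    for the past, is an ordinary random variable. *)
Lemma past_measurable i A : past Y0 Y1 K i A -> measurable A.
Proof.
apply: smallest_sub; first exact: sigma_algebra_measurable.
move=> _ [j [_ [B [mB [|]]]]] ->; rewrite -[X in measurable X]setTI.
- exact: mK.
- exact: measurable_Yobs.
Qed.

Lemma past_indicator i j : (j < i)%N -> past Y0 Y1 K i [set t | K j t = 1].
Proof.
move=> ji; apply: sub_sigma_algebra; exists j; split => //.
by exists [set 1]; split => //; left.
Qed.

Let mp i : measurable_fun setT (p i).
Proof.
move=> _ B mB; rewrite setTI; case: design => _ [_ [mp _]].
by apply: past_measurable; exact: mp mB.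
Qed.

Let bK i : bounded_rv (K i).
Proof.
split => //; exists 1 => t.
by case: (K01 i t) => ->; rewrite ?normr0 ?normr1.
Qed.

Let bp i : bounded_rv (p i).
Proof.
by split => //; exists 1 => t; case/andP: (p01 i t) => ? ?; rewrite ger0_norm.
Qed.

Let indicE_K j : K j = \1_[set t | K j t = 1].
Proof.
apply/funext => t; rewrite indicE; case: (boolP (t \in _)).
  by rewrite inE.
by rewrite notin_setE/= => K1; case: (K01 j t).
Qed.

(** The defining property of the design in expectation form: as [K i] takes only the values 0 and 1,
    [K i * \1_A] is the indicator of the event that [A] holds and unit [i] is treated. *)
Lemma Ex_past i A : past Y0 Y1 K i A ->
  Ex P (fun t => K i t * \1_A t) = Ex P (fun t => p i t * \1_A t).
Proof.
move=> pA; have mA := past_measurable pA.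
have mKi : measurable [set t | K i t = 1].
  exact: past_measurable (past_indicator (ltnSn i)).
case: design => _ [_ [_ /(_ i A pA) /(congr1 fine) KpA]].
have -> : (fun t => K i t * \1_A t) = \1_(A `&` [set t | K i t = 1]).
  by apply/funext => t; rewrite indicI {1}indicE_K/= mulrC.
move: KpA; rewrite -Ex_indic; last exact: measurableI.
rewrite /= => ->; rewrite -/(Rintegral P A (p i)) Rintegral_mkcond.
congr Ex; apply/funext => t; rewrite patchE indicE.
by case: ifPn => _; rewrite ?mulr1 ?mulr0.
Qed.

Lemma Ex_indicator i : Ex P (K i) = Ex P (p i).
Proof.
have pT : past Y0 Y1 K i setT.
  by rewrite -(setD0 setT); apply: sigma_algebraCD; exact: sigma_algebra0.
have := Ex_past pT; rewrite indicT.
by under eq_fun do rewrite mulr1; under [in RHS]eq_fun do rewrite mulr1.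
Qed.

(** After expansion, [K i] enters only through [E[K_i K_j]] and [E[K_i]]. Both are instances of
    [Ex_past], with the past event [K_j = 1] and with the whole space, so [p i] may replace
    [K i]. *)
Lemma Ex_centered i j : (j < i)%N ->
  Ex P (fun t => (K i t - q) * (K j t - q)) =
  Ex P (fun t => (p i t - q) * (K j t - q)).
Proof.
move=> ji; have KK : Ex P (fun t => K i t * K j t) = Ex P (fun t => p i t * K j t).
  by rewrite [K j]indicE_K; apply: Ex_past; exact: past_indicator.
have expand X : bounded_rv X -> Ex P (fun t => (X t - q) * (K j t - q)) =
    Ex P (fun t => X t * K j t) - q * Ex P X - (q * Ex P (K j) - q ^+ 2).
  move=> bX; rewrite -(ExZ P q bX) -(ExZ P q (bK j)) -(Ex_cst P (q ^+ 2)).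
  have bXK : bounded_rv (fun t => X t * K j t) by exact: bounded_rvM.
  have bqX : bounded_rv (fun t => q * X t) by exact: bounded_rvZ.
  have bqK : bounded_rv (fun t => q * K j t) by exact: bounded_rvZ.
  have bqq : bounded_rv (fun _ : T => q ^+ 2) := bounded_rv_cst _.
  rewrite -(ExB P bXK bqX) -(ExB P bqK bqq).
  rewrite -(ExB P (bounded_rvB bXK bqX) (bounded_rvB bqK bqq)).
  by congr Ex; apply/funext => t; ring.
by rewrite !expand// KK Ex_indicator.
Qed.

Let eps i := Ex P (fun t => `|p i t - q|).

Let bpq i : bounded_rv (fun t => p i t - q).
Proof. by apply: bounded_rvB => //; exact: bounded_rv_cst. Qed.

Let bKq i : bounded_rv (fun t => K i t - q).
Proof. by apply: bounded_rvB => //; exact: bounded_rv_cst. Qed.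

Let Kq1 i t : `|K i t - q| <= 1.
Proof. by rewrite ler_norml; move: q01; case: (K01 i t) => ->; lra. Qed.

Let pq1 i t : `|p i t - q| <= 1.
Proof. by rewrite ler_norml; move: q01 (p01 i t); lra. Qed.

Lemma mean_deviation_cvg0 : eps @ \oo --> (0 : R).
Proof.
apply/cvgrPdist_le => e e0; have e20 : 0 < e / 2 by rewrite divr_gt0.
have /fine_cvgP[_ /cvgrPdist_le/(_ _ e20) Pe] := pq e20.
near=> n; rewrite sub0r normrN ger0_norm; last exact: Rintegral_ge0.
have := Ex_norm_le P (bpq n) (pq1 n) (ltW e20); rewrite mul1r => /le_trans; apply.
rewrite [leRHS]splitr lerD2l; under eq_set do rewrite subr0.
have : `|0 - fine (P [set t | e / 2 < `|p n t - q|])| <= e / 2 by near: n.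
by rewrite sub0r normrN => /(le_trans (ler_norm _)).
Unshelve. all: by end_near. Qed.

Lemma design_weak_lln (a : nat -> R) (A : R) : (forall i, `|a i| <= A) ->
  cvg_in_prob P (fun n t => n%:R^-1 * \sum_(i < n) a i * (K i t - q)) 0.
Proof.
move=> aA; apply: (weighted_weak_lln (eps := eps) _ Kq1 aA).
- by move=> i; case: (bKq i).
(* The factor [K j - q] has absolute value at most 1, which leaves [E|p_i - q|]. *)
- move=> i j ji; rewrite Ex_centered//.
  have bM := bounded_rvM (bpq i) (bKq j).
  rewrite (le_trans (Ex_norm P bM))//; apply: Ex_le.
  + exact: bounded_rv_norm.
  + exact: bounded_rv_norm.
  + by move=> t; rewrite normrM ler_piMr.
- by move=> i; exact: Rintegral_ge0.
- exact: mean_deviation_cvg0.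
Qed.

End SequentialDesign.

(** * Continuous mapping and consistency of ratio estimators *)

Section ContinuousMapping.
Local Set Implicit Arguments.
Local Unset Strict Implicit.
Context {d : measure_display} {T : measurableType d} {R : realType}.
Variable P : probability T R.

Lemma cvg_in_prob_continuous2 (g : R -> R -> R) (X Y : nat -> T -> R) (x y : R) :
  (forall n, measurable_fun setT (X n)) ->
  (forall n, measurable_fun setT (Y n)) ->
  (forall n, measurable_fun setT (fun t => g (X n t) (Y n t))) ->
  g u.1 u.2 @[u --> (x, y)] --> g x y ->
  cvg_in_prob P X x -> cvg_in_prob P Y y ->
  cvg_in_prob P (fun n t => g (X n t) (Y n t)) (g x y).
Proof.
move=> mX mY mg cg; apply: cvg_in_prob_comp2 => // e e0.
move/cvgrPdist_le : cg => /(_ _ e0) /nbhs_ballP[r /= r0 rg].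
(* Balls are open while the deviation bounds are non-strict, hence the smaller radius. *)
exists (r / 2); first by rewrite divr_gt0.
have r2 : r / 2 < r by rewrite ltr_pdivrMr// ltr_pMr// ltr1n.
apply: nearW => n t Xr Yr; rewrite distrC; apply: (rg (X n t, Y n t)).
by split; rewrite /= -ball_normE/= distrC; exact: le_lt_trans r2.
Qed.

Lemma measurable_ratio (W : nat -> T -> R) (b : nat -> R) n :
  (forall i, measurable_fun setT (W i)) ->
  measurable_fun setT (fun t =>
    (Num.max (\sum_(i < n) W i t) 1)^-1 * \sum_(i < n) W i t * b i).
Proof.
move=> mW; apply: measurable_funM; last first.
  apply: (measurable_sum (index_enum _) (h := fun (i : 'I_n) t => W i t * b i)).
  by move=> i; exact: (measurable_funM (mW i) (measurable_cst _)).
have mS : measurable_fun setT (fun t => \sum_(i < n) W i t).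
  apply: (measurable_sum (index_enum _) (h := fun (i : 'I_n) t => W i t)) => i.
  exact: mW.
have mI : measurable_fun setT (fun x : R => (Num.max x 1)^-1).
  apply: continuous_measurable_fun => x.
  apply: cvgV; first by rewrite gt_eqF// lt_max ltr01 orbT.
  by apply: continuous_max; [exact: cvg_id|exact: cvg_cst].
exact: (measurableT_comp mI mS).
Qed.

(* On the scale 1/n the ratio is [(U_b + q mean b) / max (U_1 + q, 1/n)],
   where [U_a] is the average of the [a i * (W i - q)]. *)
Lemma cvg_in_prob_ratio (W : nat -> T -> R) (q : R) (b : nat -> R) (B m : R) :
  (forall i, measurable_fun setT (W i)) -> 0 < q ->
  (forall (a : nat -> R) (A : R), (forall i, `|a i| <= A) ->
    cvg_in_prob P (fun n t => n%:R^-1 * \sum_(i < n) a i * (W i t - q)) 0) ->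
  (forall i, `|b i| <= B) ->
  n%:R^-1 * \sum_(i < n) b i @[n --> \oo] --> m ->
  cvg_in_prob P (fun n t =>
    (Num.max (\sum_(i < n) W i t) 1)^-1 * \sum_(i < n) W i t * b i) m.
Proof.
move=> mW q0 wlln bB bm.
have a1 (i : nat) : `|cst (1 : R) i| <= 1 by rewrite normr1.
have mavg (a : nat -> R) n : measurable_fun setT
    (fun t => n%:R^-1 * \sum_(i < n) a i * (W i t - q)).
  apply: (measurable_funM (measurable_cst _)).
  apply: (measurable_sum (index_enum _)
    (h := fun (i : 'I_n) t => a i * (W i t - q))) => i.
  apply: (measurable_funM (measurable_cst _)).
  exact: (measurable_funB (mW i) (measurable_cst q)).
apply: cvg_in_prob_comp2 (wlln _ _ a1) (wlln _ _ bB); [exact: mavg..| |].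
  by move=> n; exact: measurable_ratio.
move=> e e0; have m1 : 0 < 1 + `|m| by rewrite ltr_pwDl.
(* The first bound keeps the denominator [D] above [q / 2]; the second makes the part
   [r * (1 + |m|)] of the numerator error at most [q * e / 4]. *)
pose r := Num.min (q / 2) (q * e / 4 / (1 + `|m|)).
have r0 : 0 < r by rewrite lt_min !divr_gt0// mulr_gt0.
have rq : r <= q / 2 by rewrite ge_min lexx.
have rm : r * (1 + `|m|) <= q * e / 4 by rewrite -ler_pdivlMr// ge_min lexx orbT.
exists r => //; have e40 : 0 < e / 4 by rewrite divr_gt0.
move/cvgrPdist_le : bm => /(_ _ e40) bm.
near=> n => t.
have n0 : (0 < n)%N by near: n; exact: nbhs_infty_gt.
have nR : 0 < n%:R :> R by rewrite ltr0n.
have nN0 : n%:R != 0 :> R by rewrite gt_eqF.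
(* Once [1/n <= q], truncating the denominator from below at [1/n] cannot push it further from [q]
   than it already was. *)
have nq : n%:R^-1 <= q.
  rewrite -[leRHS]invrK lef_pV2 ?posrE ?invr_gt0//; near: n; exact: nbhs_infty_ger.
have : `|m - n%:R^-1 * \sum_(i < n) b i| <= e / 4 by near: n.
rewrite subr0 subr0 /cst; set mb := n%:R^-1 * _; set S := \sum_(i < n) W i t => mbm.
have -> : n%:R^-1 * \sum_(i < n) 1 * (W i t - q) = n%:R^-1 * S - q.
  under eq_bigr do rewrite mul1r.
  by rewrite sumrB sumr_const card_ord -mulr_natr mulrBr mulrC; field.
have -> : n%:R^-1 * \sum_(i < n) b i * (W i t - q) =
    n%:R^-1 * (\sum_(i < n) W i t * b i) - q * mb.
  under eq_bigr do rewrite mulrBr (mulrC _ (W _ _)).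
  by rewrite sumrB -mulr_suml mulrBr /mb; ring.
set V := n%:R^-1 * \sum_(i < n) W i t * b i; set D := Num.max (n%:R^-1 * S) n%:R^-1.
have -> : (Num.max S 1)^-1 * \sum_(i < n) W i t * b i = V / D.
  have -> : D = n%:R^-1 * Num.max S 1 by rewrite maxr_pMr ?invr_ge0 ?ler0n// mulr1.
  have : Num.max S 1 != 0 by rewrite gt_eqF// lt_max ltr01 orbT.
  by move=> ?; rewrite /V; field; apply/andP.
move=> Ur Vr.
have Dq : `|D - q| <= r.
  move: Ur; rewrite !ler_norml /D.
  by case: (leP (n%:R^-1 * S) n%:R^-1) => ? /andP[? ?]; apply/andP; split; lra.
have D0 : q / 2 <= D by move: Dq; rewrite ler_norml => /andP[]; lra.
have Dp : 0 < D by apply: lt_le_trans D0; rewrite divr_gt0.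
(* Three errors: fluctuation of the numerator, convergence of the mean of [b], and fluctuation of
   the denominator. Together they are at most [e * (q / 2) <= e * D]. *)
have -> : V / D - m = ((V - q * mb) + (q * (mb - m) + m * (q - D))) / D.
  by field; rewrite gt_eqF.
rewrite normrM normfV (gtr0_norm Dp) ler_pdivrMr//.
apply: (@le_trans _ _ (e * (q / 2))); last by rewrite ler_pM2l.
apply: (@le_trans _ _ (r + (q * (e / 4) + `|m| * r))); last first.
  by move: rm; rewrite mulrDr mulr1 (mulrC r); lra.
rewrite (le_trans (ler_normD _ _))// lerD//.
rewrite (le_trans (ler_normD _ _))// lerD// normrM.
  by rewrite (gtr0_norm q0) ler_pM2l// distrC.
by rewrite ler_wpM2l// distrC.
Unshelve. all: by end_near. Qed.

End ContinuousMapping.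

(** * Algebra of the variance bound and the Cauchy-Schwarz inequality *)

Section Variance.
Local Set Implicit Arguments.
Local Unset Strict Implicit.
Context {R : realType}.
Implicit Types (q x y : R).

Lemma cross_odds q : 0 < q < 1 ->
  Num.sqrt (q / (1 - q)) * Num.sqrt ((1 - q) / q) = 1.
Proof.
move=> /andP[q0 q1]; have q10 : 0 < 1 - q by rewrite subr_gt0.
rewrite -sqrtrM ?divr_ge0 ?ltW//.
have -> : q / (1 - q) * ((1 - q) / q) = 1 by field; rewrite !gt_eqF.
by rewrite sqrtr1.
Qed.

(** The two odds are reciprocal, so the cross term loses its dependence on [q]. The limit of the
    estimator is thus [V_strong] with [m01] replaced by [m0 m1], and only these two numbers remain
    to be compared. *)
Lemma sqr_sqrt_sum q x y : 0 < q < 1 -> 0 <= x -> 0 <= y ->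
  (Num.sqrt x * Num.sqrt (q / (1 - q)) + Num.sqrt y * Num.sqrt ((1 - q) / q)) ^+ 2
  = V_strong q x y (Num.sqrt x * Num.sqrt y).
Proof.
move=> q01 x0 y0; have cross := cross_odds q01; have /andP[q0 q1] := q01.
have q10 : 0 < 1 - q by rewrite subr_gt0.
rewrite sqrrD !exprMn !sqr_sqrtr ?divr_ge0 ?(ltW q0) ?(ltW q10)//.
by rewrite mulrACA cross mulr1 /V_strong; ring.
Qed.

(** The weights are built from the limits [u], [v] and do not vary with [n], so the bound is linear
    in the averages, passes to the limit directly, and becomes [u * v] there. *)
Lemma limit_cauchy_schwarz (Y0 Y1 : nat -> R) (m0sq m1sq m01 : R) :
  n%:R^-1 * \sum_(i < n) Y0 i ^+ 2 @[n --> \oo] --> m0sq ->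
  n%:R^-1 * \sum_(i < n) Y1 i ^+ 2 @[n --> \oo] --> m1sq ->
  n%:R^-1 * \sum_(i < n) Y0 i * Y1 i @[n --> \oo] --> m01 ->
  0 < m0sq -> 0 < m1sq -> m01 <= Num.sqrt m0sq * Num.sqrt m1sq.
Proof.
move=> c0 c1 c01 m0 m1.
pose u := Num.sqrt m0sq; pose v := Num.sqrt m1sq.
have u0 : 0 < u by rewrite sqrtr_gt0.
have v0 : 0 < v by rewrite sqrtr_gt0.
(* AM-GM: [2 Y0 Y1 <= (v / u) Y0^2 + (u / v) Y1^2] *)
have -> : Num.sqrt m0sq * Num.sqrt m1sq = 2^-1 * (v / u * m0sq + u / v * m1sq).
  rewrite -/u -/v -(sqr_sqrtr (ltW m0)) -(sqr_sqrtr (ltW m1)) -/u -/v.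
  by field; rewrite !gt_eqF.
have cs : 2^-1 * (v / u * (n%:R^-1 * \sum_(i < n) Y0 i ^+ 2) +
    u / v * (n%:R^-1 * \sum_(i < n) Y1 i ^+ 2)) @[n --> \oo] -->
    2^-1 * (v / u * m0sq + u / v * m1sq).
  by apply: cvgMl_tmp; apply: cvgD; exact: cvgMl_tmp.
apply: (ler_cvg_to c01 cs); apply: nearW => n.
rewrite !(mulrCA _ n%:R^-1) -mulrDr mulrCA ler_wpM2l ?invr_ge0//.
rewrite !mulr_sumr -big_split/= mulr_sumr; apply: ler_sum => i _.
(* The gap in each summand is a nonnegative multiple of a square. *)
have -> : 2^-1 * (v / u * Y0 i ^+ 2 + u / v * Y1 i ^+ 2) =
    Y0 i * Y1 i + (v * Y0 i - u * Y1 i) ^+ 2 / (2 * (u * v)).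
  by field; rewrite !gt_eqF.
by rewrite lerDl divr_ge0 ?sqr_ge0// !mulr_ge0// ltW.
Qed.

End Variance.

(** * Consistency of the moment estimators, conservativeness and the additive case *)

Theorem theorem2 (d : measure_display) (T : measurableType d) (R : realType)
  (P : probability T R) (Y0 Y1 : nat -> R) (K : nat -> T -> R) (p : nat -> T -> R)
  (pstar m0sq m1sq m01 : R) :
  sequential_design P Y0 Y1 K p ->
  (* strong design stability *)
  0 < pstar < 1 ->
  cvg_in_prob P p pstar ->
  (* Assumption A (a) *)
  (exists delta : R, 0 < delta < 1 /\ forall i t, delta <= p i t <= 1 - delta) ->
  (* Assumption A (b) *)
  (exists M : R, 0 < M /\ forall i, `|Y0 i| <= M /\ `|Y1 i| <= M) ->
  (* Assumption A (c) *)
  (fun N : nat => (N%:R)^-1 * \sum_(i < N) Y0 i ^+ 2) @ \oo --> m0sq ->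
  (fun N : nat => (N%:R)^-1 * \sum_(i < N) Y1 i ^+ 2) @ \oo --> m1sq ->
  (fun N : nat => (N%:R)^-1 * \sum_(i < N) Y0 i * Y1 i) @ \oo --> m01 ->
  0 < m0sq -> 0 < m1sq ->
  cvg_in_prob P (hat_m0sq Y0 Y1 K) m0sq /\
  cvg_in_prob P (hat_m1sq Y0 Y1 K) m1sq /\
  cvg_in_prob P (hat_V_strong pstar Y0 Y1 K)
    ((Num.sqrt m0sq * Num.sqrt (pstar / (1 - pstar)) +
      Num.sqrt m1sq * Num.sqrt ((1 - pstar) / pstar)) ^+ 2) /\
  V_strong pstar m0sq m1sq m01 <=
    (Num.sqrt m0sq * Num.sqrt (pstar / (1 - pstar)) +
     Num.sqrt m1sq * Num.sqrt ((1 - pstar) / pstar)) ^+ 2 /\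
  ((exists c : R, 0 < c /\ forall i, Y1 i = c * Y0 i) ->
    cvg_in_prob P (hat_V_strong pstar Y0 Y1 K) (V_strong pstar m0sq m1sq m01)).
Proof.
move=> design q01 pq [delta [/andP[delta0 _] pdelta]] [M [M0 YM]] c0 c1 c01 m0 m1.
have /andP[q0 q1] := q01.
have p01 i t : 0 <= p i t <= 1 by have := pdelta i t; lra.
have qle : 0 <= pstar <= 1 by lra.
have [mK [K01 _]] := design.
pose W i t := 1 - K i t.
have mW i : measurable_fun setT (W i).
  exact: (measurable_funB (measurable_cst (1 : R)) (mK i)).
have wK := design_weak_lln design p01 qle pq.
(* For control indicators, [W i - (1 - pstar) = - (K i - pstar)], so this is the law for [K] with
   weights [- a]. *)
have wW (a : nat -> R) (A : R) : (forall i, `|a i| <= A) -> cvg_in_prob P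
    (fun n t => n%:R^-1 * \sum_(i < n) a i * (W i t - (1 - pstar))) 0.
  move=> aA; have naA i : `|- a i| <= A by rewrite normrN.
  have := wK (fun i => - a i) A naA; congr cvg_in_prob.
  apply/funext => n; apply/funext => t.
  by congr (_ * _); apply: eq_bigr => i _; rewrite /W; ring.
have sqB (y : nat -> R) : (forall i, `|y i| <= M) ->
    forall i, `|y i ^+ 2| <= M ^+ 2.
  by move=> yM i; rewrite normrX ler_sqr ?nnegrE// ltW.
(* On control units the observed outcome is [Y0 i], and the other units have weight 0; this gives
   the deterministic weights that [cvg_in_prob_ratio] expects. *)
have E0 : hat_m0sq Y0 Y1 K = fun n t =>
    (Num.max (\sum_(i < n) W i t) 1)^-1 * \sum_(i < n) W i t * Y0 i ^+ 2.
  apply/funext => n; apply/funext => t; rewrite /hat_m0sq /N0 /N1.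
  congr ((Num.max _ 1)^-1 * _); first by rewrite sumrB sumr_const card_ord.
  by apply: eq_bigr => i _; rewrite /W /Yobs; case: (K01 i t) => ->; ring.
have E1 : hat_m1sq Y0 Y1 K = fun n t =>
    (Num.max (\sum_(i < n) K i t) 1)^-1 * \sum_(i < n) K i t * Y1 i ^+ 2.
  apply/funext => n; apply/funext => t; congr (_ * _).
  by apply: eq_bigr => i _; rewrite /Yobs; case: (K01 i t) => ->; ring.
have cm0 : cvg_in_prob P (hat_m0sq Y0 Y1 K) m0sq.
  rewrite E0; apply: (cvg_in_prob_ratio mW _ wW (sqB Y0 _) c0).
    by rewrite subr_gt0.
  by move=> i; case: (YM i).
have cm1 : cvg_in_prob P (hat_m1sq Y0 Y1 K) m1sq.
  by rewrite E1; apply: (cvg_in_prob_ratio mK q0 wK (sqB Y1 _) c1) => i; case: (YM i).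
have mm0 n : measurable_fun setT (hat_m0sq Y0 Y1 K n).
  by rewrite E0; exact: (measurable_ratio (fun i => Y0 i ^+ 2) n mW).
have mm1 n : measurable_fun setT (hat_m1sq Y0 Y1 K n).
  by rewrite E1; exact: (measurable_ratio (fun i => Y1 i ^+ 2) n mK).
have cV : cvg_in_prob P (hat_V_strong pstar Y0 Y1 K)
    ((Num.sqrt m0sq * Num.sqrt (pstar / (1 - pstar)) +
      Num.sqrt m1sq * Num.sqrt ((1 - pstar) / pstar)) ^+ 2).
  pose g (x y : R) := (Num.sqrt x * Num.sqrt (pstar / (1 - pstar)) +
    Num.sqrt y * Num.sqrt ((1 - pstar) / pstar)) ^+ 2.
  apply: (cvg_in_prob_continuous2 (g := g)) => //.
  - have msqrt : measurable_fun setT (@Num.sqrt R).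
      exact: (continuous_measurable_fun (@sqrt_continuous R)).
    move=> n; apply: measurable_funX; apply: measurable_funD.
    + exact: (measurable_funM (measurableT_comp msqrt (mm0 n)) (measurable_cst _)).
    + exact: (measurable_funM (measurableT_comp msqrt (mm1 n)) (measurable_cst _)).
  - rewrite /g; under eq_fun do rewrite expr2; rewrite expr2.
    have cg : Num.sqrt u.1 * Num.sqrt (pstar / (1 - pstar)) +
        Num.sqrt u.2 * Num.sqrt ((1 - pstar) / pstar) @[u --> (m0sq, m1sq)] -->
        Num.sqrt m0sq * Num.sqrt (pstar / (1 - pstar)) +
        Num.sqrt m1sq * Num.sqrt ((1 - pstar) / pstar).
      apply: cvgD; apply: cvgMr_tmp; apply: continuous_cvg;
        [exact: sqrt_continuous|exact: cvg_fst|exact: sqrt_continuous|exact: cvg_snd].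
    exact: cvgM.
split => //; split => //; split => //.
rewrite (sqr_sqrt_sum q01 (ltW m0) (ltW m1)); split.
  by rewrite lerD2l ler_pM2l//; exact: limit_cauchy_schwarz c0 c1 c01 m0 m1.
move=> [c [cpos Y1E]]; suff <- : Num.sqrt m0sq * Num.sqrt m1sq = m01.
  by rewrite -(sqr_sqrt_sum q01 (ltW m0) (ltW m1)).
(* Uniqueness of limits expresses [m01], and then [m1sq], through [c] and [m0sq]. *)
have m01E : m01 = c * m0sq.
  apply: (cvg_unique _ c01) => //; rewrite [X in X @ _](_ : _ =
      fun N : nat => c * (N%:R^-1 * \sum_(i < N) Y0 i ^+ 2)); first exact: cvgMl_tmp.
  apply/funext => n; rewrite [RHS]mulrCA [X in _ = _ * X]mulr_sumr; congr (_ * _).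
  by apply: eq_bigr => i _; rewrite Y1E; ring.
have m1E : m1sq = c ^+ 2 * m0sq.
  apply: (cvg_unique _ c1) => //; rewrite [X in X @ _](_ : _ =
      fun N : nat => c ^+ 2 * (N%:R^-1 * \sum_(i < N) Y0 i ^+ 2)).
    exact: cvgMl_tmp.
  apply/funext => n; rewrite [RHS]mulrCA [X in _ = _ * X]mulr_sumr; congr (_ * _).
  by apply: eq_bigr => i _; rewrite Y1E; ring.
(* Here [m0 m1 = |c| * m0sq], which equals [m01 = c * m0sq] because [c] is positive; for negative
   [c] it would be [- m01], and the limit would strictly exceed [V_strong]. *)
rewrite m1E m01E sqrtrM ?sqr_ge0// sqrtr_sqr gtr0_norm// mulrCA -expr2.
by rewrite sqr_sqrtr ?ltW.
Qed.
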